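(* Let $\nu>0$, let $\mathbf{x}_0\in\mathbb{R}^n$, and let $\Theta=\{\mathbf{x}_1,\dots,\mathbf{x}_{n+1}\}\subset\mathbb{R}^n$ be a set of $n+1$ affinely independent vectors. Let $G=\sum_{i=0}^{n+1}\ell_i(\mathbf{x}_0)\,\mathbf{x}_i\mathbf{x}_i^T\in\mathbb{R}^{n\times n}$ and let $\lambda_1,\dots,\lambda_n$ be the eigenvalues of the real symmetric matrix $G$ (with multiplicity). Then the maximum of $|\hat f(\mathbf{x}_0)-f(\mathbf{x}_0)|$ over all quadratic functions $f\in C^{1,1}_\nu(\mathbb{R}^n)$ equals $$\underline z(\Theta,\mathbf{x}_0)=\frac{\nu}{2}\sum_{i=1}^n|\lambda_i| .$$
   Context: $C^{1,1}_\nu(\mathbb{R}^n)$ is the class of continuously differentiable functions $f:\mathbb{R}^n\to\mathbb{R}$ whose derivative satisfies $\|Df(\mathbf{u})-Df(\mathbf{v})\|\le\nu\|\mathbf{u}-\mathbf{v}\|$ for all $\mathbf{u},\mathbf{v}\in\mathbb{R}^n$ (Euclidean norms). A quadratic function is a function of the form $f(\mathbf{u})=c+\mathbf{g}\cdot\mathbf{u}+\frac12 (H\mathbf{u})\cdot\mathbf{u}$ with $c\in\mathbb{R}$, $\mathbf{g}\in\mathbb{R}^n$, $H\in\mathbb{R}^{n\times n}$ symmetric. For each $f$, $\hat f$ is the unique affine function with $\hat f(\mathbf{x}_i)=f(\mathbf{x}_i)$ for $i=1,\dots,n+1$. For $i=1,\dots,n+1$, $\ell_i$ is the Lagrange polynomial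 of $\Theta$, i.e. the unique affine function with $\ell_i(\mathbf{x}_j)=1$ if $j=i$ and $\ell_i(\mathbf{x}_j)=0$ if $j\ne i$ ($j=1,\dots,n+1$); additionally $\ell_0\equiv-1$. *)

(* Defs.v *)
From mathcomp Require Import all_boot all_order all_algebra.
From mathcomp Require Import all_classical all_reals all_analysis.
Import Order.TTheory GRing.Theory Num.Theory.
Import numFieldNormedType.Exports.

Set Implicit Arguments.
Unset Strict Implicit.
Unset Printing Implicit Defensive.

Local Open Scope classical_set_scope.
Local Open Scope ring_scope.

Section Definitions.
Variables (R : realType) (n : nat).

Definition dot (u v : 'cV[R]_n) : R := \sum_i u i 0 * v i 0.

(* The library norm on matrices is the sup norm. It induces the same topology,
   hence the same derivatives, but Lipschitz constants have to be measured with
   the Euclidean norm. *)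
Definition enorm (u : 'cV[R]_n) : R := Num.sqrt (dot u u).

(* The vector representing the linear functional ['d f u]; meaningful when [f]
   is differentiable at [u]. *)
Definition grad (f : 'cV[R]_n -> R) (u : 'cV[R]_n) : 'cV[R]_n :=
  \col_i 'd f u (delta_mx i 0).

Definition C11 (nu : R) (f : 'cV[R]_n -> R) : Prop :=
  [/\ forall u, differentiable f u,
      continuous (grad f) &
      forall u v, enorm (grad f u - grad f v) <= nu * enorm (u - v)].

Definition quadratic (f : 'cV[R]_n -> R) : Prop :=
  exists (c : R) (g : 'cV[R]_n) (H : 'M[R]_n),
    H^T = H /\ forall u, f u = c + dot g u + 2^-1 * dot (H *m u) u.

Definition affine (f : 'cV[R]_n -> R) : Prop :=
  exists (c : R) (g : 'cV[R]_n), forall u, f u = c + dot g u.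

Definition affinely_independent m (x : 'I_m -> 'cV[R]_n) : Prop :=
  forall c : 'I_m -> R,
    \sum_i c i = 0 -> \sum_i c i *: x i = 0 -> forall i, c i = 0.

Definition interpolates (x : 'I_n.+1 -> 'cV[R]_n) (y : 'I_n.+1 -> R)
    (f : 'cV[R]_n -> R) : Prop :=
  affine f /\ forall i, f (x i) = y i.

(* The affine function with value [y i] at [x i]; it exists and is unique when
   [x] is affinely independent, see [affine_interpP]. *)
Definition affine_interp (x : 'I_n.+1 -> 'cV[R]_n) (y : 'I_n.+1 -> R) :
    'cV[R]_n -> R :=
  xget (fun=> 0) [set f | interpolates x y f].

Definition lagrange (x : 'I_n.+1 -> 'cV[R]_n) (i : 'I_n.+1) : 'cV[R]_n -> R :=
  affine_interp x (fun j => (j == i)%:R).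

(* A family [x : 'I_n.+2 -> 'cV_n] lists the evaluation point [x ord0] followed
   by the [n.+1] interpolation nodes. *)
Definition nodes (x : 'I_n.+2 -> 'cV[R]_n) : 'I_n.+1 -> 'cV[R]_n :=
  fun i => x (lift ord0 i).

Definition ell (x : 'I_n.+2 -> 'cV[R]_n) (i : 'I_n.+2) : 'cV[R]_n -> R :=
  if unlift ord0 i is Some j then lagrange (nodes x) j else (fun=> - 1).

Definition Gmx (x : 'I_n.+2 -> 'cV[R]_n) : 'M[R]_n :=
  \sum_i ell x i (x ord0) *: (x i *m (x i)^T).

(* [lambda] lists the eigenvalues of [A] with their multiplicities. *)
Definition eigenvalues_of (A : 'M[R]_n) (lambda : 'I_n -> R) : Prop :=
  char_poly A = \prod_i ('X - (lambda i)%:P).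

End Definitions.

Definition is_maximum (R : realType) (S : set R) (m : R) : Prop :=
  S m /\ ubound S m.

Section Interpolation.
Variables (R : realType) (n : nat) (x : 'I_n.+1 -> 'cV[R]_n).
Hypothesis hx : affinely_independent x.

Let A : 'M[R]_(n.+1) := \matrix_i row_mx (1%:M : 'M[R]_1) (x i)^T.

Let AE (w : 'cV[R]_(1 + n)) i :
  (A *m w) i 0 = w (lshift n 0) 0 + dot (dsubmx w) (x i).
Proof.
rewrite mxE (@big_split_ord _ _ _ 1 n) /= big_ord1; congr (_ + _).
  by rewrite [A _ _]mxE (@row_mxEl _ 1 1) mxE mul1r.
apply: eq_bigr => j _.
by rewrite [A _ _]mxE (@row_mxEr _ 1 1) !mxE mulrC.
Qed.

Let Aunit : A \in unitmx.
Proof.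
rewrite -row_free_unit; apply/inj_row_free => v vA.
have key (j : 'I_(1 + n)) :
    \sum_i v 0 i * row_mx (1%:M : 'M[R]_1) (x i)^T 0 j = 0.
  have := congr1 (fun M : 'rV[R]_(n.+1) => M 0 j) vA.
  rewrite !mxE => h; rewrite -[RHS]h; apply: eq_bigr => i _.
  by rewrite [A _ _]mxE.
apply/rowP => i; rewrite mxE; apply: (hx (c := fun i => v 0 i)).
- have := key (lshift n 0); rewrite (eq_bigr (fun i => v 0 i)) // => k _.
  by rewrite row_mxEl mxE mulr1.
- apply/colP => j; rewrite summxE [RHS]mxE -[RHS](key (rshift 1 j)).
  by apply: eq_bigr => k _; rewrite row_mxEr !mxE.
Qed.

Lemma affine_interp_ex (y : 'I_n.+1 -> R) : exists f, interpolates x y f.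
Proof.
pose w : 'cV[R]_(1 + n) := invmx A *m (\col_i y i).
exists (fun u => w (lshift n 0) 0 + dot (dsubmx w) u); split.
  by exists (w (lshift n 0) 0), (dsubmx w).
by move=> i; rewrite -AE mulKVmx // mxE.
Qed.

Lemma affine_interp_uniq (y : 'I_n.+1 -> R) f g :
  interpolates x y f -> interpolates x y g -> f = g.
Proof.
move=> [[c [p fE]] fy] [[d [q gE]] gy].
suff e : col_mx (c%:M : 'cV[R]_1) p = col_mx (d%:M : 'cV[R]_1) q.
  apply/funext => u; rewrite fE gE; have [/colP e1 ->] := eq_col_mx e.
  by have := e1 0; rewrite !mxE /= !mulr1n => ->.
apply: (can_inj (mulKmx Aunit)); apply/colP => i; rewrite !AE.
rewrite !col_mxKd !col_mxEu !mxE /= !mulr1n.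
by rewrite -fE -gE fy gy.
Qed.

Lemma affine_interpP (y : 'I_n.+1 -> R) :
  interpolates x y (affine_interp x y) /\
  forall f, interpolates x y f -> f = affine_interp x y.
Proof.
have h : interpolates x y (affine_interp x y).
  have [f hf] := affine_interp_ex y.
  exact: (xgetPex (P := [set f | interpolates x y f]) (fun=> 0) (ex_intro _ f hf)).
by split => // f hf; apply: affine_interp_uniq hf h.
Qed.

End Interpolation.

(* Main.v *)
Require Import Defs.
From HB Require Import structures.
From mathcomp Require Import all_boot all_order all_algebra.
From mathcomp Require Import all_classical all_reals all_analysis.
From mathcomp Require Import ring lra.
Import Order.TTheory GRing.Theory Num.Theory.
Import numFieldNormedType.Exports.

(** Write [x_0] for the evaluation point and [x_1, ..., x_(n+1)] for the nodes.
    The interpolation error is the linear functional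
    [f |-> \sum_i ell_i(x_0) * f(x_i)], because [ell_0 = -1]
    ([interpolation_error]). It kills affine functions, so on a quadratic
    function with Hessian [H] only the second-order part survives, and this
    part is a trace: the error equals [tr (H G) / 2]
    ([interpolation_error_quadratic]). The gradient of such a function is
    [g + H u], so it belongs to the class [C11 nu] exactly when
    [|H u| <= nu |u|] for all [u] ([C11_quadraticP]).

    It remains to maximize [|tr (H G)|] over the symmetric matrices [H] of
    operator norm at most [nu], which is the duality between the operator norm
    and the trace norm. Let [G = P^T D P] with [P] orthogonal and [D] the
    diagonal matrix of the eigenvalues. Then [tr (H G)] is the sum of the
    [lambda_i * (p_i . H p_i)], where the [p_i] are the rows of [P]; these are
    unit vectors, so each factor [p_i . H p_i] lies in [-nu, nu]
    ([normr_trace_le]). All the bounds are attained at once when [H] has the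
    same eigenvectors as [G], with eigenvalues [nu * sg lambda_i]
    ([enorm_sign_mx], [trace_sign_mx]).

    The orthogonal diagonalization ([orthogonal_diagonalization]) is obtained
    by deflation: the characteristic polynomial is assumed to split over the
    reals, so a real unit eigenvector is available at each step, and a
    Householder reflection moves it to the first basis vector. *)

Set Implicit Arguments.
Unset Strict Implicit.
Unset Printing Implicit Defensive.

Local Open Scope classical_set_scope.
Local Open Scope ring_scope.

(** * Orthogonal diagonalization *)

Section Diagonalization.
Variable R : rcfType.

Lemma mulmx_tr_ge0 n (v : 'rV[R]_n) : 0 <= (v *m v^T) 0 0.
Proof. by rewrite mxE sumr_ge0 // => i _; rewrite mxE -expr2 sqr_ge0. Qed.

Lemma mulmx_tr_eq0 n (v : 'rV[R]_n) : ((v *m v^T) 0 0 == 0) = (v == 0).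
Proof.
apply/eqP/eqP => [|->]; last by rewrite mul0mx mxE.
rewrite mxE => /eqP.
rewrite psumr_eq0 => [/allP h|i _]; last by rewrite mxE -expr2 sqr_ge0.
apply/rowP => i; have := h i (mem_index_enum i); rewrite !mxE -expr2 sqrf_eq0.
by move/eqP.
Qed.

(** The reflection in the hyperplane orthogonal to [u - v] exchanges the unit
    vectors [u] and [v]; for [u = v] the identity does. *)
Lemma householder_reflection n (u v : 'rV[R]_n) :
  u *m u^T = 1%:M -> v *m v^T = 1%:M ->
  exists Q : 'M[R]_n, [/\ Q^T = Q, Q *m Q = 1%:M & u *m Q = v].
Proof.
move=> uu vv; pose w := u - v.
have [w0|w0] := eqVneq w 0.
  exists 1%:M; rewrite trmx1 mulmx1 mulmx1; split=> //.
  by apply/eqP; rewrite -subr_eq0; apply/eqP.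
pose a := (w *m w^T) 0 0.
have a0 : a != 0 by rewrite mulmx_tr_eq0.
have wwE : w *m w^T = a%:M by rewrite [LHS]mx11_scalar.
(* Both vectors have norm 1, so [u . (u - v)] is half of [|u - v|^2]. *)
have uwE : u *m w^T = (a / 2)%:M.
  have vuE : v *m u^T = u *m v^T.
    by rewrite -[v]trmxK -trmx_mul trmxK [u *m _]mx11_scalar tr_scalar_mx.
  have : w *m w^T = 2 *: (u *m w^T).
    rewrite /w linearB /= !mulmxBl !mulmxBr uu vv vuE opprB addrACA -opprD.
    by rewrite scaler_nat mulr2n opprD addrACA.
  rewrite wwE => /(congr1 (fun M => 2^-1 *: M)).
  by rewrite scalerK ?pnatr_eq0 // scale_scalar_mx mulrC.
exists (1%:M - (2 / a) *: (w^T *m w)); split.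
- by rewrite linearB /= linearZ /= trmx_mul trmxK trmx1.
- set M := w^T *m w.
  have MM : M *m M = a *: M.
    by rewrite mulmxA -(mulmxA w^T) wwE mul_mx_scalar scalemxAl.
  rewrite mulmxBr mulmx1 mulmxBl mul1mx -scalemxAl -scalemxAr MM !scalerA.
  rewrite opprB -addrA -[- (_ *: M)]scaleNr -!scalerDl [X in X *: _](_ : _ = 0).
    by rewrite scale0r addr0.
  by field.
- rewrite mulmxBr mulmx1 -scalemxAr mulmxA uwE mul_scalar_mx scalerA.
  by rewrite (_ : _ * _ = 1) ?scale1r ?subKr //; field.
Qed.

Lemma char_poly_conj n (A Q : 'M[R]_n) : Q *m Q = 1%:M ->
  char_poly (Q *m A *m Q) = char_poly A.
Proof.
move=> QQ; rewrite /char_poly /char_poly_mx !map_mxM /=.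
set q := map_mx _ Q; set a := map_mx _ A.
have qq : q *m q = 1%:M by rewrite -map_mxM QQ map_mx1.
have -> : 'X%:M - q *m a *m q = q *m ('X%:M - a) *m q.
  by rewrite mulmxBr mulmxBl mul_mx_scalar -scalemxAl qq scalemx1.
by rewrite !det_mulmx mulrAC -det_mulmx qq det1 mul1r.
Qed.

Lemma char_poly_block_diag m n (A : 'M[R]_m) (B : 'M[R]_n) :
  char_poly (block_mx A 0 0 B) = char_poly A * char_poly B.
Proof.
rewrite /char_poly /char_poly_mx map_block_mx !map_mx0 scalar_mx_block.
by rewrite opp_block_mx add_block_mx !oppr0 !addr0 det_ublock.
Qed.

(** Induction on the dimension: in an orthonormal basis that starts with an
    eigenvector for [l ord0], the matrix is block diagonal, and the lower block
    is symmetric with the remaining [l i] as the roots of its characteristic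
    polynomial. *)
Lemma orthogonal_diagonalization n (A : 'M[R]_n) (l : 'I_n -> R) :
  A^T = A -> char_poly A = \prod_i ('X - (l i)%:P) ->
  exists P : 'M[R]_n,
    P *m P^T = 1%:M /\ A = P^T *m diag_mx (\row_i l i) *m P.
Proof.
elim: n A l => [|n IHn] A l symA charA.
  by exists 1%:M; split; rewrite ?trmx1 ?mulmx1 // ![RHS]flatmx0 [LHS]flatmx0.
have : eigenvalue A (l ord0).
  by rewrite eigenvalue_root_char charA big_ord_recl rootM root_XsubC eqxx.
case/eigenvalueP => v0 v0A v0_neq0.
pose s := (v0 *m v0^T) 0 0; have s_gt0 : 0 < s.
  by rewrite lt0r mulmx_tr_eq0 v0_neq0 mulmx_tr_ge0.
pose v := (Num.sqrt s)^-1 *: v0.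
have vA : v *m A = l ord0 *: v.
  by rewrite -scalemxAl v0A !scalerA mulrC.
have vv : v *m v^T = 1%:M.
  rewrite linearZ /= -scalemxAl -scalemxAr scalerA [v0 *m _]mx11_scalar.
  rewrite scale_scalar_mx -/s -invfM -expr2 sqr_sqrtr ?ltW //.
  by rewrite mulVf // gt_eqF.
pose e : 'rV[R]_(1 + n) := row_mx 1%:M 0.
have ee : e *m e^T = 1%:M.
  by rewrite tr_row_mx mul_row_col trmx1 mul1mx trmx0 mulmx0 addr0.
have [Q [symQ QQ eQ]] := householder_reflection ee vv.
pose B : 'M[R]_(1 + n) := Q *m A *m Q.
have symB : B^T = B by rewrite !trmx_mul symQ symA mulmxA.
have eB : e *m B = l ord0 *: e.
  by rewrite !mulmxA eQ vA -eQ -scalemxAl -mulmxA QQ mulmx1.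
(* The first row of [B] is [l ord0 *: e]; symmetry clears its first column. *)
have [B' symB' defB] : exists2 B' : 'M[R]_n, B'^T = B' &
    B = block_mx (l ord0)%:M 0 0 B'.
  exists (drsubmx B); move: eB symB; rewrite -[B]submxK !block_mxKdr => eB.
    by rewrite tr_block_mx => /eq_block_mx[].
  move: eB; rewrite mul_row_block !mul1mx !mul0mx !addr0 scale_row_mx.
  case/eq_row_mx; rewrite scaler0 scalemx1 => -> ur0.
  by rewrite tr_block_mx => /eq_block_mx[_ _]; rewrite ur0 trmx0 => <-.
have charB' : char_poly B' = \prod_i ('X - (l (lift ord0 i))%:P).
  have := charA; rewrite -(char_poly_conj A QQ) -/B defB.
  rewrite (@char_poly_block_diag 1 n).
  rewrite big_ord_recl [X in X * _](_ : _ = 'X - (l ord0)%:P).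
    by apply: mulfI; rewrite polyXsubC_eq0.
  by rewrite char_poly_trig ?big_ord1 ?mxE ?eqxx // ?is_trig_mx11.
have [P' [PP defB']] := IHn B' _ symB' charB'.
pose P : 'M[R]_(1 + n) := block_mx 1%:M 0 0 P' *m Q.
have AE : A = Q *m B *m Q.
  by rewrite /B !mulmxA QQ mul1mx -mulmxA QQ mulmx1.
have diagE : diag_mx (\row_i l i) =
    block_mx (l ord0)%:M 0 0 (diag_mx (\row_i l (lift ord0 i)))
    :> 'M[R]_(1 + n).
  have -> : \row_i l i =
      row_mx (l ord0)%:M (\row_i l (lift ord0 i) : 'rV[R]_n) :> 'rV[R]_(1 + n).
    apply/rowP => i; rewrite mxE.
    case: (@split_ordP 1 n i) => j ->; rewrite ?row_mxEl ?row_mxEr mxE.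
      by rewrite !ord1 eqxx; congr l; apply: val_inj.
    by congr l; apply: val_inj.
  rewrite (@diag_mx_row R n 1); congr (block_mx _ _ _ _).
  by apply/matrixP => i j; rewrite !ord1 !mxE.
have PPT : P *m P^T = 1%:M.
  rewrite trmx_mul symQ mulmxA -(mulmxA _ Q Q) QQ mulmx1 tr_block_mx trmx1.
  rewrite !trmx0 mulmx_block !mul0mx !mulmx0 !mulmx1 !addr0 add0r PP.
  by rewrite -scalar_mx_block.
have defB2 : B = (block_mx 1%:M 0 0 P')^T *m
    block_mx (l ord0)%:M 0 0 (diag_mx (\row_i l (lift ord0 i))) *m
    block_mx 1%:M 0 0 P' :> 'M[R]_(1 + n).
  rewrite tr_block_mx trmx1 !trmx0 !mulmx_block.
  rewrite !mul0mx !mulmx0 !mul1mx !mulmx1 !addr0 !add0r !mul0mx.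
  by rewrite defB defB'.
exists P; split=> //.
by rewrite diagE AE defB2 trmx_mul symQ !mulmxA.
Qed.

End Diagonalization.

(** * Euclidean geometry *)

Section Euclid.
Variables (R : realType) (n : nat).
Implicit Types (u v w : 'cV[R]_n) (H : 'M[R]_n).

Lemma dotE u v : dot u v = (u^T *m v) 0 0.
Proof. by rewrite mxE; apply: eq_bigr => i _; rewrite mxE. Qed.

Lemma dotC u v : dot u v = dot v u.
Proof. by apply: eq_bigr => i _; rewrite mulrC. Qed.

Lemma dotDl u v w : dot (u + v) w = dot u w + dot v w.
Proof. by rewrite !dotE linearD mulmxDl mxE. Qed.

Lemma dotZl a u v : dot (a *: u) v = a * dot u v.
Proof. by rewrite !dotE linearZ -scalemxAl mxE. Qed.

Lemma dotDr u v w : dot w (u + v) = dot w u + dot w v.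
Proof. by rewrite !(dotC w) dotDl. Qed.

Lemma dotZr a u v : dot v (a *: u) = a * dot v u.
Proof. by rewrite !(dotC v) dotZl. Qed.

Lemma dot_ge0 u : 0 <= dot u u.
Proof. by rewrite sumr_ge0 // => i _; rewrite -expr2 sqr_ge0. Qed.

Lemma dot_mul_sym H u v : H^T = H -> dot (H *m u) v = dot u (H *m v).
Proof. by move=> symH; rewrite !dotE trmx_mul symH mulmxA. Qed.

Lemma dot_delta u i : dot u (delta_mx i 0) = u i 0.
Proof.
rewrite /dot (bigD1 i) //= mxE !eqxx mulr1 big1 ?addr0 // => j /negPf ji.
by rewrite mxE ji mulr0.
Qed.

Lemma enorm_le_scale (nu : R) u v : 0 <= nu ->
  (enorm u <= nu * enorm v) = (dot u u <= nu ^+ 2 * dot v v).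
Proof.
move=> nu0; rewrite -ler_sqr ?nnegrE ?mulr_ge0 ?sqrtr_ge0 //.
by rewrite exprMn !sqr_sqrtr ?dot_ge0.
Qed.

(** Cauchy-Schwarz with a unit vector; it follows from the nonnegativity of
    [|v + nu u|^2] and [|v - nu u|^2]. *)
Lemma normr_dot_le (nu : R) u v : 0 < nu ->
  dot u u = 1 -> dot v v <= nu ^+ 2 -> `|dot u v| <= nu.
Proof.
move=> nu0 uu vv.
have := dot_ge0 (v + nu *: u); have := dot_ge0 (v - nu *: u).
rewrite -scaleNr !(dotDl, dotDr, dotZl, dotZr) uu (dotC v u) => h1 h2.
rewrite ler_norml; apply/andP; split; nra.
Qed.

Lemma trace_rank1 H u : \tr (H *m (u *m u^T)) = dot (H *m u) u.
Proof. by rewrite mulmxA mxtrace_mulC dotC dotE /mxtrace big_ord1. Qed.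

End Euclid.

(** * Quadratic functions in the class C11 *)

Section Calculus.
Variables (R : realType) (n : nat).

Lemma is_diff_bigsum (V W : normedModType R) m (F dF : 'I_m -> V -> W) u :
  (forall i, is_diff u (F i) (dF i)) ->
  is_diff u (fun v => \sum_i F i v) (fun v => \sum_i dF i v).
Proof.
move=> dFi; elim: m F dF dFi => [|m IHm] F dF dFi.
  rewrite (_ : (fun v => _) = cst 0); last first.
    by apply/funext => v; rewrite big_ord0.
  rewrite (_ : (fun v => _) = 0); last by apply/funext => v; rewrite big_ord0.
  exact: is_diff_cst.
rewrite (_ : (fun v => \sum_i F i v) =
  F ord0 + fun v => \sum_i F (lift ord0 i) v); last first.
  by apply/funext => v; rewrite big_ord_recl.
rewrite (_ : (fun v => \sum_i dF i v) =
  dF ord0 + fun v => \sum_i dF (lift ord0 i) v); last first.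
  by apply/funext => v; rewrite big_ord_recl.
by apply: is_diffD; apply: IHm => i.
Qed.

Lemma is_diff_coord (u : 'cV[R]_n) i :
  is_diff u (fun v : 'cV[R]_n => v i 0) (fun v : 'cV[R]_n => v i 0).
Proof.
apply: DiffDef; first exact: differentiable_coord.
have lin : linear (fun v : 'cV[R]_n => v i 0) by move=> a v w; rewrite !mxE.
pose linM := GRing.isLinear.Build _ _ _ _ _ lin.
pose f : {linear 'cV[R]_n -> R} := HB.pack (fun v : 'cV[R]_n => v i 0) linM.
rewrite (_ : (fun v : 'cV[R]_n => v i 0) = f) //.
exact/diff_lin/coord_continuous.
Qed.

Lemma is_diff_dot (F G dF dG : 'cV[R]_n -> 'cV[R]_n) (u : 'cV[R]_n) :
  (forall i, is_diff u (fun v => F v i 0) (fun v => dF v i 0)) ->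
  (forall i, is_diff u (fun v => G v i 0) (fun v => dG v i 0)) ->
  is_diff u (fun v => dot (F v) (G v))
    (fun v => dot (F u) (dG v) + dot (dF v) (G u)).
Proof.
move=> dFi dGi.
have := @is_diff_bigsum _ _ n (fun i => (fun v => F v i 0) * (fun v => G v i 0))
  (fun i => F u i 0 *: (fun v => dG v i 0) + G u i 0 *: (fun v => dF v i 0)) u.
move=> /(_ (fun i => is_diffM _ _)) h.
apply: is_diff_eq h _; apply/funext => v; rewrite /dot -big_split /=.
by apply: eq_bigr => i _; rewrite [X in _ + X = _]mulrC.
Qed.

Lemma is_diff_dotl (g u : 'cV[R]_n) : is_diff u (dot g) (dot g).
Proof.
have dg i : is_diff u (fun=> g i 0) (fun=> (0 : 'cV[R]_n) i 0).
  by apply: is_diff_eq (is_diff_cst _ _) _; apply/funext => v; rewrite mxE.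
apply: is_diff_eq (is_diff_dot dg (is_diff_coord u)) _; apply/funext => v.
by rewrite [X in _ + X]big1 ?addr0 // => j _; rewrite mxE mul0r.
Qed.

Lemma is_diff_mulmx (H : 'M[R]_n) (u : 'cV[R]_n) i :
  is_diff u (fun v : 'cV[R]_n => (H *m v) i 0) (fun v => (H *m v) i 0).
Proof.
have mulE v : (H *m v) i 0 = dot (row i H)^T v.
  by rewrite dotE trmxK -row_mul [RHS]mxE.
by rewrite (funext mulE); exact: is_diff_dotl.
Qed.

Variables (c : R) (g : 'cV[R]_n) (H : 'M[R]_n).
Hypothesis symH : H^T = H.
Let q u := c + dot g u + 2^-1 * dot (H *m u) u.

Lemma is_diff_quadratic u : is_diff u q (dot (g + H *m u)).
Proof.
have d1 := is_diff_dotl g u.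
have d2 := is_diff_dot (is_diff_mulmx H u) (is_diff_coord u).
have h := is_diffD (is_diffD (is_diff_cst c u) d1) (is_diffZ 2^-1 d2).
apply: is_diff_eq h _; apply/funext => v /=.
rewrite dotDl; congr (_ + _); first exact: add0r.
rewrite -[LHS]/(2^-1 * (dot (H *m u) v + dot (H *m v) u)).
rewrite (dot_mul_sym v u symH) (dotC v).
by field.
Qed.

Lemma grad_quadratic u : grad q u = g + H *m u.
Proof.
have d := is_diff_quadratic u.
by apply/colP => i; rewrite mxE diff_val dot_delta.
Qed.

(** The gradient is itself differentiable, which is checked on its expansion in
    the canonical basis. *)
Lemma continuous_grad_quadratic : continuous (grad q).
Proof.
rewrite (_ : grad q =
  \sum_i (fun v => (g i 0 + (H *m v) i 0) *: delta_mx i 0)).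
  move=> u; apply/differentiable_continuous/differentiable_sum => i.
  apply/differentiableZl.
  by have [] := is_diffD (is_diff_cst (g i 0) u) (is_diff_mulmx H u i).
apply/funext => v; rewrite grad_quadratic fct_sumE [LHS]matrix_sum_delta.
by apply: eq_bigr => i _; rewrite big_ord1 mxE.
Qed.

Lemma C11_quadraticP (nu : R) :
  C11 nu q <-> forall u, enorm (H *m u) <= nu * enorm u.
Proof.
split=> [[_ _ lip] u|lip].
  by have := lip u 0; rewrite !grad_quadratic mulmx0 addr0 addrC addKr subr0.
split=> [u| |u v]; first by have [] := is_diff_quadratic u.
  exact: continuous_grad_quadratic.
rewrite !grad_quadratic opprD addrACA subrr add0r -mulmxBr; exact: lip.
Qed.

End Calculus.

(** * The interpolation error as a trace *)

Section InterpolationError.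
Variables (R : realType) (n : nat) (x : 'I_n.+2 -> 'cV[R]_n).
Hypothesis hx : affinely_independent (nodes x).

Lemma affine_bigsum m (y : 'I_m -> R) (F : 'I_m -> 'cV[R]_n -> R) :
  (forall j, affine (F j)) -> affine (fun u => \sum_j F j u * y j).
Proof.
move=> /choice[c /choice[g FE]].
exists (\sum_j c j * y j), (\sum_j y j *: g j) => u.
under eq_bigr do rewrite FE mulrDl.
rewrite big_split /=; congr (_ + _).
rewrite dotE raddf_sum mulmx_suml summxE; apply: eq_bigr => j _.
by rewrite -dotE dotZl mulrC.
Qed.

(** The function [\sum_j f(x_j) * lagrange_j] interpolates [f], so it is the
    affine interpolant; the term [- f (x_0)] is the one of index 0, where
    [ell] is [-1]. *)
Lemma interpolation_error (f : 'cV[R]_n -> R) :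
  affine_interp (nodes x) (f \o nodes x) (x ord0) - f (x ord0) =
  \sum_i ell x i (x ord0) * f (x i).
Proof.
have [_ uniq] := affine_interpP hx (f \o nodes x).
rewrite big_ord_recl {1}/ell unlift_none mulN1r addrC; congr (_ + _).
rewrite -(uniq (fun u => \sum_j Defs.lagrange (nodes x) j u * f (nodes x j))).
  by apply: eq_bigr => j _; rewrite /ell liftK.
have lagrangeP j := (affine_interpP hx (fun k => (k == j)%:R)).1.
split=> [|i]; first by apply: affine_bigsum => j; case: (lagrangeP j).
have lagrangeE j : Defs.lagrange (nodes x) j (nodes x i) = (i == j)%:R.
  exact: (lagrangeP j).2.
rewrite (bigD1 i) //= lagrangeE eqxx mul1r big1 ?addr0 // => j ji.
by rewrite lagrangeE eq_sym (negPf ji) mul0r.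
Qed.

(** An affine function is its own interpolant. *)
Lemma interpolation_error_affine (f : 'cV[R]_n -> R) : affine f ->
  \sum_i ell x i (x ord0) * f (x i) = 0.
Proof.
move=> af; rewrite -interpolation_error.
have [_ /(_ f) <- //] := affine_interpP hx (f \o nodes x).
by rewrite subrr.
Qed.

Lemma interpolation_error_quadratic c g (H : 'M[R]_n) :
  let f u := c + dot g u + 2^-1 * dot (H *m u) u in
  affine_interp (nodes x) (f \o nodes x) (x ord0) - f (x ord0) =
  2^-1 * \tr (H *m Gmx x).
Proof.
move=> f; rewrite interpolation_error.
under eq_bigr do rewrite /f mulrDr.
rewrite big_split /= (interpolation_error_affine (f := fun u => c + dot g u)).
  rewrite add0r /Gmx mulmx_sumr raddf_sum mulr_sumr; apply: eq_bigr => i _.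
  by rewrite -scalemxAr /= mxtraceZ trace_rank1 mulrCA.
by exists c, g.
Qed.

Lemma Gmx_sym : (Gmx x)^T = Gmx x.
Proof.
rewrite /Gmx raddf_sum; apply: eq_bigr => i _.
by rewrite /= linearZ /= trmx_mul trmxK.
Qed.

End InterpolationError.

(** * Duality between the operator norm and the trace norm *)

Section TraceNorm.
Variables (R : realType) (n : nat) (P : 'M[R]_n) (l : 'I_n -> R).
Hypothesis PPT : P *m P^T = 1%:M.
Let G := P^T *m diag_mx (\row_i l i) *m P.

Lemma dot_orthogonal u : dot (P *m u) (P *m u) = dot u u.
Proof.
by rewrite !dotE trmx_mul mulmxA -(mulmxA _ P^T) (mulmx1C PPT) mulmx1.
Qed.

(** In the orthonormal basis formed by the rows [p i] of [P], the trace of [H G]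
    is the sum of the [(p i . H p i) * l i], and [|p i . H p i| <= nu]. *)
Lemma normr_trace_le (nu : R) (H : 'M[R]_n) : 0 < nu ->
  (forall u, enorm (H *m u) <= nu * enorm u) ->
  `|\tr (H *m G)| <= nu * \sum_i `|l i|.
Proof.
move=> nu0 Hnu; pose p i := (row i P)^T.
have pp i : dot (p i) (p i) = 1.
  have := congr1 (fun M : 'M[R]_n => M i i) PPT.
  rewrite dotE trmxK !mxE eqxx => h; rewrite -[RHS]h.
  by apply: eq_bigr => j _; rewrite !mxE.
have pHp i : dot (p i) (H *m p i) = (P *m H *m P^T) i i.
  rewrite dotE trmxK mulmxA -row_mul; set M := P *m H.
  by rewrite !mxE; apply: eq_bigr => j _; rewrite !mxE.
have -> : \tr (H *m G) = \sum_i dot (p i) (H *m p i) * l i.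
  rewrite /G !mulmxA mxtrace_mulC !mulmxA mul_mx_diag; apply: eq_bigr => i _.
  by rewrite pHp [LHS]mxE [(\row_i l i) _ _]mxE.
rewrite mulr_sumr; apply: le_trans (ler_norm_sum _ _ _) _.
apply: ler_sum => i _; rewrite normrM ler_wpM2r //.
apply: normr_dot_le => //.
by have := Hnu (p i); rewrite (enorm_le_scale _ _ (ltW nu0)) pp mulr1.
Qed.

(** The matrix with the eigenvectors of [G] and the eigenvalues
    [nu * sg (l i)], at which the bound above is attained. *)
Let S (nu : R) := nu *: (P^T *m diag_mx (\row_i Num.sg (l i)) *m P).

Lemma tr_sign_mx nu : (S nu)^T = S nu.
Proof. by rewrite linearZ /= !trmx_mul trmxK tr_diag_mx mulmxA. Qed.

Lemma enorm_sign_mx nu u : 0 <= nu -> enorm (S nu *m u) <= nu * enorm u.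
Proof.
move=> nu0; rewrite enorm_le_scale // -scalemxAl dotZl dotZr mulrA -expr2.
rewrite ler_wpM2l ?sqr_ge0 // -dot_orthogonal -[leRHS]dot_orthogonal.
rewrite !mulmxA PPT mul1mx -mulmxA; apply: ler_sum => i _.
rewrite mul_diag_mx !mxE -!expr2 exprMn ler_piMl ?sqr_ge0 //.
by rewrite sqr_sg; case: eqP.
Qed.

Lemma trace_sign_mx nu : \tr (S nu *m G) = nu * \sum_i `|l i|.
Proof.
rewrite -scalemxAl mxtraceZ /G !mulmxA -(mulmxA _ P) PPT mulmx1.
rewrite mxtrace_mulC !mulmxA PPT mul1mx mulmx_diag mxtrace_diag.
by congr (_ * _); apply: eq_bigr => i _; rewrite !mxE normrEsg.
Qed.

End TraceNorm.

Theorem mainTheorem5 (R : realType) (n : nat) (nu : R) (x : 'I_n.+2 -> 'cV[R]_n)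
    (lambda : 'I_n -> R) :
  0 < nu ->
  affinely_independent (nodes x) ->
  eigenvalues_of (Gmx x) lambda ->
  is_maximum
    [set `|affine_interp (nodes x) (f \o nodes x) (x ord0) - f (x ord0)|
       | f in [set f : 'cV[R]_n -> R | quadratic f /\ C11 nu f]]
    (nu / 2 * \sum_(i < n) `|lambda i|).
Proof.
move=> nu0 hx charG.
have [P [PPT GE]] := orthogonal_diagonalization (Gmx_sym x) charG.
have halfE s : nu / 2 * s = 2^-1 * (nu * s) by rewrite mulrA (mulrC nu).
split.
  pose H := nu *: (P^T *m diag_mx (\row_i Num.sg (lambda i)) *m P).
  exists (fun u => 0 + dot 0 u + 2^-1 * dot (H *m u) u).
    have symH : H^T = H by exact: tr_sign_mx.
    split; first by exists 0, 0, H.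
    by apply/C11_quadraticP => // u; apply: enorm_sign_mx => //; exact: ltW.
  rewrite interpolation_error_quadratic // GE trace_sign_mx // halfE.
  by rewrite ger0_norm // !mulr_ge0 ?invr_ge0 ?sumr_ge0 // ltW.
move=> _ [f [[c [g [H [symH fE]]]] C11f] <-].
have {fE} fE := funext fE; rewrite fE in C11f *.
have {C11f} /C11_quadraticP Hnu := C11f.
rewrite interpolation_error_quadratic // halfE normrM gtr0_norm ?invr_gt0 //.
by rewrite ler_pM2l ?invr_gt0 // GE normr_trace_le //; exact: Hnu.
Qed.
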